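(* Let $k \geq 2$ and $n \geq 2$ be integers such that $k$ is odd and $n \equiv 2 \pmod{2k}$. Let $L$ be a graph of order $n$ that has exactly one edge. Then the following hold. (a) There is a partial $k$-star decomposition of $K_n$ whose leave is $L$. (b) There is no $k$-star decomposition of $L \vee K_{k-1}$, even though $|E(L \vee K_{k-1})| \equiv 0 \pmod{k}$. (c) If $k$ is a power of an odd prime, then there is no $k$-star decomposition of $L \vee K_{s}$ for any nonnegative integer $s<2k-2$.
   Context: All graphs are finite and simple. A $k$-star is a complete bipartite graph $K_{1,k}$. A $k$-star decomposition of a graph $G$ is a set of $k$-stars that are subgraphs of $G$ such that each edge of $G$ is in exactly one of the $k$-stars. A partial $k$-star decomposition of $G$ is a set of $k$-stars that are subgraphs of $G$ such that each edge of $G$ is in at most one of the $k$-stars; its leave is the graph with vertex set $V(G)$ whose edges are exactly the edges of $G$ that are in none of its $k$-stars. For vertex-disjoint graphs $G$ and $H$, $G \vee H$ is the graph obtained from the union of $G$ and $H$ by adding every edge between a vertex of $G$ and a vertex of $H$; $G \vee K_0$ is taken to be $G$. $K_m$ denotes the complete graph on $m$ vertices, and $E(G)$ the edge set of $G$. *)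

(* Defs.v *)
From HB Require Import structures.
From mathcomp Require Import all_boot.

Set Implicit Arguments.
Unset Strict Implicit.
Unset Printing Implicit Defensive.

(* Edges are two-element sets of vertices.  Since the well-formedness condition
   is boolean, two graphs on T are Leibniz-equal iff their edge sets are. *)
Record sgraph (T : finType) := SGraph {
  edges :> {set {set T}};
  edgesP : [forall e in edges, #|e| == 2]
}.

HB.instance Definition _ (T : finType) := [isSub for @edges T].

Section Graphs.
Variable T : finType.
Implicit Types (G : sgraph T) (D : {set {set {set T}}}).

Lemma complete_subproof :
  [forall e in [set e : {set T} | #|e| == 2], #|e| == 2].
Proof. by apply/forall_inP=> e; rewrite inE. Qed.

Definition complete : sgraph T := SGraph complete_subproof.

(* A star with k > 0 leaves has no isolated vertex, so as a subgraph it is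
   identified with its edge set. *)
Definition is_star (k : nat) (S : {set {set T}}) : Prop :=
  exists (c : T) (X : {set T}),
    [/\ c \notin X, #|X| = k & S = [set [set c; x] | x in X]].

Definition stars_in (k : nat) G D : Prop :=
  forall S, S \in D -> is_star k S /\ S \subset edges G.

Definition star_decomposition (k : nat) G D : Prop :=
  stars_in k G D /\
  (forall e, e \in edges G -> #|[set S in D | e \in S]| = 1).

Definition partial_star_decomposition (k : nat) G D : Prop :=
  stars_in k G D /\
  (forall e, e \in edges G -> #|[set S in D | e \in S]| <= 1).

Lemma leave_subproof G D : [forall e in edges G :\: cover D, #|e| == 2].
Proof.
apply/forall_inP=> e; rewrite inE => /andP[_ eG].
exact: (forall_inP (edgesP G)).
Qed.

Definition leave G D : sgraph T := SGraph (leave_subproof G D).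

End Graphs.

Arguments complete T : clear implicits.

Section Join.
Variables (T U : finType) (G : sgraph T) (H : sgraph U).

Definition join_edges : {set {set T + U}} :=
  [set [set inl x | x in e] | e : {set T} in edges G]
  :|: [set [set inr y | y in e] | e : {set U} in edges H]
  :|: [set [set inl x; inr y] | x in [set: T], y in [set: U]].

Lemma join_subproof : [forall e in join_edges, #|e| == 2].
Proof.
apply/forall_inP=> e; rewrite /join_edges 2!inE => /orP[/orP[]|].
- case/imsetP=> f fG ->; rewrite card_imset; last by move=> ? ? [].
  exact: (forall_inP (edgesP G)).
- case/imsetP=> f fH ->; rewrite card_imset; last by move=> ? ? [].
  exact: (forall_inP (edgesP H)).
- by case/imset2P=> x y _ _ ->; rewrite cards2.
Qed.

(* The vertex-disjoint union is realised by the sum type; for empty U this is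
   G itself, on the vertex type T + U. *)
Definition join : sgraph (T + U)%type := SGraph join_subproof.

End Join.

(* Main.v *)
Require Import Defs.
From mathcomp Require Import all_boot all_algebra zify.

Set Implicit Arguments.
Unset Strict Implicit.
Unset Printing Implicit Defensive.

(** A k-star decomposition is the same thing as an orientation of the graph in
    which every out-degree is a multiple of k: orient the edges of each star
    away from its centre, and conversely cut every out-neighbourhood into blocks
    of size k ([star_decompositionP]).  All three parts are questions about such
    orientations.  Write n = 2km + 2 and let uv be the edge of L.

    Existence ([star_orientation_complete_minus_edge]): let u beat every vertex
    except v, which gives it out-degree 2km, and put on the 2km + 1 vertices
    other than u a regular tournament, whose out-degrees are all km.

    Non-existence for s < k ([join_no_star_decomposition]): in the join of L
    and K_s a vertex of L has degree s < k, or s + 1 <= k if it is u or v.  Hence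
    the only vertex of L with a nonzero out-degree is the tail of uv, say u, and
    u then beats all its neighbours, so that s + 1 = k.  A vertex w of K_s
    therefore beats the n - 1 = 2km + 1 vertices of L other than u, and at most
    s - 1 = k - 2 further vertices; its out-degree lies strictly between 2km and
    2km + k, which excludes a multiple of k.

    Counting ([dvdn_edges_join_complete]): for odd k the size of the join is a
    multiple of k exactly when (s + 1)(s + 2) is.  This holds for s = k - 1.  If
    k is a prime power it has to divide s + 1 or s + 2, because these are
    coprime, and neither is possible when k <= s < 2k - 2. *)

(** * Star decompositions and orientations *)

Lemma eq_set2 (T : finType) (x y a b : T) :
  [set x; y] = [set a; b] -> x = a /\ y = b \/ x = b /\ y = a.
Proof.
move=> eq_xy.
have xab : x \in [set a; b] by rewrite -eq_xy set21.
have yab : y \in [set a; b] by rewrite -eq_xy set22.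
have := set21 a b; have := set22 a b; rewrite -eq_xy => {eq_xy}.
case/set2P: xab => ->; case/set2P: yab => ->; rewrite ?setUid ?inE.
- by move=> /eqP->; left.
- by left.
- by right.
- by move=> _ /eqP->; left.
Qed.

Lemma equipartition (T : finType) (A : {set T}) k :
  0 < k -> k %| #|A| ->
  exists2 P, partition P A & forall B, B \in P -> #|B| = k.
Proof.
move=> k_gt0 /dvdnP[q]; elim: q A => [|q IHq] A cardA.
  exists set0 => [|B]; last by rewrite inE.
  by move/eqP: cardA; rewrite cards_eq0 => /eqP->; rewrite partition_set0.
have /card_gt0P[B] : 0 < #|[set B : {set T} | B \subset A & #|B| == k]|.
  by rewrite cards_draws bin_gt0 cardA leq_pmull.
rewrite inE => /andP[sBA /eqP cardB].
have [|P partP cardP] := IHq (A :\: B).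
  by rewrite cardsDS // cardA cardB mulSn addKn.
exists (B |: P) => [|C /setU1P[-> //|/cardP //]].
rewrite -(setID A B) (setIidPr sBA) partitionU1 //.
  by rewrite -card_gt0 cardB.
by rewrite disjoint_sym -setI_eq0 setDE -setIA [~: B :&: B]setIC setICr setI0.
Qed.

Section Orientations.
Variables (T : finType) (k : nat).
Implicit Types (E S : {set {set T}}) (N : T -> {set T}).

(** [N x] is the out-neighbourhood of x.  Edges form a bare set, so that the
    notion applies to graphs and to single stars alike. *)
Definition star_orientation E N : Prop :=
  [/\ forall x y, ([set x; y] \in E) = (x \in N y) || (y \in N x),
      forall x y, y \in N x -> x \notin N y
    & forall x, k %| #|N x|].

Lemma card_star S : is_star k S -> #|S| = k.
Proof.
case=> c [X [cX <- ->]]; apply: card_in_imset => x y xX yX.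
case/eq_set2=> [[_ ->] //|[_ xc]].
by rewrite -xc xX in cX.
Qed.

Lemma star_orientation_star S :
  is_star k S -> exists N, star_orientation S N.
Proof.
case=> c [X [cX cardX ->]].
exists (fun x => if x == c then X else set0); split=> [x y|x y|x].
- apply/imsetP/idP => [[z zX /eq_set2[[-> ->]|[-> ->]]]|].
  + by rewrite eqxx zX orbT.
  + by rewrite eqxx zX.
  case/orP; case: eqP => [->|_]; rewrite ?inE // => zX.
    by exists x => //; rewrite setUC.
  by exists y.
- case: eqP => [->|_]; last by rewrite inE.
  by move=> yX; case: eqP => [_|_]; rewrite ?inE.
by case: eqP; rewrite ?cards0 // cardX.
Qed.

(** From a decomposition D, take the union of orientations of its stars: since
    the stars are edge-disjoint, at each vertex the out-neighbourhoods coming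
    from different stars are disjoint, so the out-degrees add up.  From an
    orientation, each block of size k of an out-neighbourhood [N x] spans a star
    centred at x. *)
Lemma star_decompositionP (G : sgraph T) : 0 < k ->
  (exists D, star_decomposition k G D) <->
  (exists N, star_orientation (edges G) N).
Proof.
move=> k_gt0; split=> [[D [Dstars Dcover]]|[N [NE Nasym Ndvd]]].
  have /fin_all_exists[O orientO] S :
      exists N, S \in D -> star_orientation S N.
    have [/Dstars[/star_orientation_star[N oN] _]|_] := boolP (S \in D).
      by exists N.
    by exists (fun=> set0).
  have uniqD S S' e : S \in D -> S' \in D -> e \in S -> e \in S' -> S = S'.
    move=> SD S'D eS eS'.
    have eG : e \in edges G by have [_ /subsetP->] := Dstars S SD.
    have /eqP/cards1P[S0 defD] := Dcover e eG.
    have inS0 R : R \in D -> e \in R -> R = S0.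
      by move=> RD eR; apply/set1P; rewrite -defD inE RD.
    by rewrite (inS0 S) // (inS0 S').
  have OS S x y : S \in D -> y \in O S x -> [set x; y] \in S.
    by move=> SD yx; have [-> _ _] := orientO S SD; rewrite yx orbT.
  exists (fun x => \bigcup_(S in D) O S x); split=> [x y|x y|x].
  - apply/idP/orP=> [xyG|].
      have /eqP/cards1P[S defS] := Dcover _ xyG.
      have := set11 S; rewrite -defS inE => /andP[SD].
      have [-> _ _] := orientO S SD.
      by case/orP=> h; [left|right]; apply/bigcupP; exists S.
    case=> /bigcupP[S SD /OS xyS]; have [_ /subsetP-> //] := Dstars S SD.
      by rewrite setUC xyS.
    exact: xyS.
  - case/bigcupP=> S SD yx; apply/negP=> /bigcupP[S' S'D xy].
    have eqS : S = S'.
      by apply: uniqD (OS _ _ _ SD yx) _ => //; rewrite setUC OS.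
    have [_ asym _] := orientO S SD.
    by move/asym/negP: yx; rewrite eqS.
  have -> : #|\bigcup_(S in D) O S x| = \sum_(S in D) #|O S x|.
    under [RHS]eq_bigr do rewrite -sum1_card big_mkcond.
    rewrite exchange_big -sum1_card big_mkcond /=; apply: eq_bigr => y _.
    case: ifP => [/bigcupP[S SD yS]|/bigcupP yN].
      rewrite (bigD1 S) //= yS big1 ?addn0 // => S' /andP[S'D neqS].
      case: ifP => // yS'; case/eqP: neqS.
      by apply: uniqD (OS _ _ _ S'D yS') (OS _ _ _ SD yS).
    rewrite big1 // => S SD; case: ifP => // yS.
    by case: yN; exists S.
  by apply: dvdn_sum => S SD; have [_ _ ->] := orientO S SD.
(* The converse: [P x] is a partition of [N x] into blocks of size k. *)
have /fin_all_exists2[P partP cardP] x := equipartition k_gt0 (Ndvd x).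
pose star (p : T * {set T}) := [set [set p.1; y] | y in p.2].
have star_arc x B e : B \in P x -> e \in star (x, B) ->
    exists y, [/\ y \in B, y \in N x & e = [set x; y]].
  move=> BP /imsetP[y yB ->]; exists y; split=> //.
  exact: subsetP (partitionS (partP x) BP) y yB.
exists [set star p | p in [set p | p.2 \in P p.1]]; split=> [S|e eG].
  case/imsetP=> -[x B]; rewrite inE /= => BP ->; split.
    exists x, B; split=> //; last exact: cardP BP.
    apply/negP=> /(subsetP (partitionS (partP x) BP)) xNx.
    by move/negP: (Nasym _ _ xNx).
  apply/subsetP=> e /(star_arc _ _ _ BP)[y [_ yNx ->]].
  by rewrite NE yNx orbT.
have [x [y [yNx ->]]] : exists x y, y \in N x /\ e = [set x; y].
  have /cards2P[x [y [_ def_e]]] := forall_inP (edgesP G) e eG.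
  move: eG; rewrite def_e NE => /orP[xNy|yNx]; last by exists x, y.
  by exists y, x; rewrite setUC.
have /and3P[/eqP covP trivP _] := partP x.
have yP : y \in cover (P x) by rewrite covP.
(* The only star through the arc from x to y is the one on the block of y. *)
rewrite -(cards1 (star (x, pblock (P x) y))); apply: eq_card => S.
rewrite !inE; apply/andP/eqP=> [[/imsetP[[x' B]]]|->]; last first.
  split; first by rewrite imset_f // inE pblock_mem.
  by apply/imsetP; exists y; rewrite ?mem_pblock.
rewrite inE /= => BP -> /(star_arc _ _ _ BP)[y' [yB yN]].
case/eq_set2=> -[eqx eqy]; last first.
  by move: (Nasym _ _ yNx); rewrite eqx eqy yN.
by subst x' y'; rewrite (def_pblock trivP BP yB).
Qed.

Lemma dvdn_card_edges (G : sgraph T) D :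
  star_decomposition k G D -> k %| #|edges G|.
Proof.
case=> Dstars Dcover.
have -> : #|edges G| = \sum_(S in D) #|S|.
  under [RHS]eq_bigr do rewrite -sum1_card big_mkcond.
  rewrite exchange_big -sum1_card big_mkcond /=; apply: eq_bigr => e _.
  rewrite -big_mkcondr /= sum1_card.
  case: ifP => [/Dcover<-|eG]; first by apply: eq_card => S; rewrite inE.
  apply/esym/eqP/pred0P=> S /=; apply/negP=> /andP[/Dstars[_ /subsetP sSG]].
  by move/sSG; rewrite eG.
by apply: dvdn_sum => S /Dstars[/card_star->].
Qed.

End Orientations.

(** * Decomposing a complete graph minus an edge *)

(** The rotational tournament: number A by the integers modulo 2h + 1 and let x
    beat the h vertices that follow it cyclically.  It is a tournament because
    exactly one of d and -d lies in [1, h] when d is nonzero modulo 2h + 1. *)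
Lemma regular_tournament (T : finType) (A : {set T}) h :
  #|A| = (2 * h).+1 ->
  exists N : T -> {set T},
    [/\ forall x y, x \in A -> y \in A -> x != y ->
          (y \in N x) = (x \notin N y),
        forall x y, y \in N x -> [/\ x \in A, y \in A & x != y]
      & forall x, x \in A -> #|N x| = h].
Proof.
move=> cardA; have /card_gt0P[x0 x0A] : 0 < #|A| by rewrite cardA.
pose f y : 'I_(2 * h).+1 := cast_ord cardA (enum_rank_in x0A y).
pose g i : T := enum_val (cast_ord (esym cardA) i).
have gA i : g i \in A by apply: enum_valP.
have fK : {in A, cancel f g}.
  by move=> x xA; rewrite /g /f cast_ordK enum_rankK_in.
have gK : cancel g f.
  by move=> i; rewrite /g /f enum_valK_in cast_ordKV.
pose N x := [set y in A | (x \in A) && (0 < (f y - f x)%R <= h)].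
exists N; split=> [x y xA yA neq_xy|x y|x xA].
- rewrite !inE xA yA !andTb -(GRing.opprB (f y)).
  have : (f y - f x)%R != 0%R.
    by rewrite GRing.subr_eq0; apply: contra_neq neq_xy => /(can_in_inj fK)->.
  move: (f y - f x)%R => d d0; have {d0} d_gt0 : 0 < d by rewrite lt0n.
  by rewrite [val (- d)%R]/= modn_small; have := ltn_ord d; lia.
- rewrite inE => /and4P[-> -> lt0 _]; split=> //.
  by apply: contraTneq lt0 => ->; rewrite GRing.subrr.
have lt_h (i : 'I_h) : i.+1 < (2 * h).+1 by have := ltn_ord i; lia.
have -> : N x = [set g (f x + Ordinal (lt_h i))%R | i in 'I_h].
  apply/setP=> y; rewrite inE xA andTb; apply/andP/imsetP=> [[yA]|[i _ ->]].
    case def_d: (f y - f x)%R => [[|d] lt_d] //= le_dh.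
    exists (Ordinal le_dh) => //; rewrite -[y in LHS]fK //; congr g.
    apply/eqP; rewrite GRing.addrC -GRing.subr_eq def_d; exact/eqP/val_inj.
  by rewrite gA gK [(f x + _)%R]GRing.addrC GRing.addrK /= ltn_ord.
rewrite card_imset ?card_ord // => i j /(can_inj gK)/GRing.addrI/(congr1 val).
by case=> /ord_inj.
Qed.

(** The vertex u beats all others except v, and the others, an odd number of
    vertices, carry a regular tournament of degree k * m. *)
Lemma star_orientation_complete_minus_edge (T : finType) k m (u v : T) :
  u != v -> #|T| = 2 * k * m + 2 ->
  exists N, star_orientation k (edges (complete T) :\ [set u; v]) N.
Proof.
move=> neq_uv cardT.
have [|N [Ntot Nsub cardN]] := @regular_tournament T (~: [set u]) (k * m).
  by rewrite cardsC1 cardT mulnA; lia.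
have uN x : u \in N x = false.
  by apply/negP=> /Nsub[_]; rewrite !inE eqxx.
exists (fun x => if x == u then ~: [set u; v] else N x).
have edgeE x y : ([set x; y] \in edges (complete T) :\ [set u; v]) =
    (x != y) && ([set x; y] != [set u; v]).
  by rewrite !inE cards2 andbC; case: (x != y).
split=> [x y|x y|x].
- rewrite edgeE; have [->|neq_xy] := eqVneq x y.
    rewrite andFb; case: eqP => [->|_]; first by rewrite !inE eqxx.
    by rewrite orbb; apply/esym/negP=> /Nsub[_ _ /eqP].
  have [eq_xu|neq_xu] := eqVneq x u; have [eq_yu|neq_yu] := eqVneq y u.
  + by rewrite eq_xu eq_yu eqxx in neq_xy.
  + rewrite eq_xu uN /= !inE negb_or neq_yu /=; congr (~~ _).
    apply/eqP/eqP=> [|-> //]; case/eq_set2=> -[] // uv.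
    by rewrite uv eqxx in neq_uv.
  + rewrite eq_yu uN orbF !inE negb_or neq_xu /= setUC; congr (~~ _).
    apply/eqP/eqP=> [|-> //]; case/eq_set2=> -[] // uv.
    by rewrite uv eqxx in neq_uv.
  + rewrite /= (Ntot x) ?inE // orbN.
    by apply/eqP=> /eq_set2[[xu _]|[_ yu]]; [case/eqP: neq_xu|case/eqP: neq_yu].
- have [->|neq_xu] := eqVneq x u.
    by rewrite !inE negb_or => /andP[/negPf-> _]; rewrite uN.
  have [->|neq_yu] := eqVneq y u; first by rewrite uN.
  by move=> yx; have [xA yA nxy] := Nsub _ _ yx; rewrite -Ntot.
case: eqP => [_|/eqP neq_xu]; last by rewrite cardN ?inE // dvdn_mulr.
by rewrite cardsCs setCK cards2 neq_uv cardT addnK -mulnA mulnCA dvdn_mulr.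
Qed.

Lemma sgraph_one_edge (T : finType) (G : sgraph T) :
  #|edges G| = 1 -> exists u v, u != v /\ edges G = [set [set u; v]].
Proof.
move/eqP/cards1P=> [e defG].
have eG : e \in edges G by rewrite defG set11.
have /cards2P[u [v [neq_uv def_e]]] := forall_inP (edgesP G) e eG.
by exists u, v; rewrite defG def_e.
Qed.

(** A partial decomposition of G with leave H amounts to a decomposition of
    G minus the edges of H. *)
Lemma partial_star_decomposition_leave (T : finType) (G H : sgraph T) k :
  0 < k -> edges H \subset edges G ->
  (exists N, star_orientation k (edges G :\: edges H) N) ->
  exists D, partial_star_decomposition k G D /\ leave G D = H.
Proof.
move=> k_gt0 sHG orientGH.
(* G minus H is a graph, namely the leave of the one-element family H. *)
have [D [Dstars Dcover]] :
    exists D, star_decomposition k (leave G [set edges H]) D.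
  by apply/star_decompositionP; rewrite //= /cover big_set1.
rewrite /= /cover big_set1 in Dcover.
have sDGH S : S \in D -> S \subset edges G :\: edges H.
  by move/Dstars=> [_]; rewrite /= /cover big_set1.
exists D; split.
  split=> [S SD|e eG].
    have [starS _] := Dstars S SD; split=> //.
    exact: subset_trans (sDGH S SD) (subsetDl _ _).
  have [eH|eH] := boolP (e \in edges H); last by rewrite Dcover // inE eH.
  rewrite leqNgt; apply/negP=> /ltnW/card_gt0P[S].
  by rewrite inE => /andP[/sDGH/subsetP sS /sS]; rewrite inE eH.
apply: val_inj; rewrite /=; suff -> : cover D = edges G :\: edges H.
  by rewrite setDDr setDv set0U (setIidPr sHG).
apply/eqP; rewrite eqEsubset; apply/andP; split.
  by apply/bigcupsP.
apply/subsetP=> e /Dcover/eqP/cards1P[S defD].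
have := set11 S; rewrite -defD inE => /andP[SD eS].
by apply/bigcupP; exists S.
Qed.

(** * Edges of a join *)

Section Join.
Variables (T U : finType) (G : sgraph T) (H : sgraph U).

Let inl_inj : injective (@inl T U).
Proof. by move=> ? ? []. Qed.

Let inr_inj : injective (@inr T U).
Proof. by move=> ? ? []. Qed.

Lemma mem_join_inl (x y : T) :
  ([set inl x; inl y] \in edges (join G H)) = ([set x; y] \in edges G).
Proof.
have {1}-> : [set inl x; inl y] = inl @: [set x; y] :> {set T + U}.
  by rewrite imsetU1 imset_set1.
rewrite !inE mem_imset; last exact: imset_inj.
rewrite -orbA; apply: orb_idr; case/orP.
  case/imsetP=> e _ /setP/(_ (inl x)).
  by rewrite imset_f ?set21 // => /esym/imsetP[].
case/imset2P=> a b _ _ /setP/(_ (inr b)).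
by rewrite set22 => /imsetP[].
Qed.

Lemma mem_join_inlr (x : T) (y : U) :
  [set inl x; inr y] \in edges (join G H).
Proof. by apply/setUP; right; apply: imset2_f; rewrite ?inE. Qed.

Lemma card_join :
  #|edges (join G H)| = #|edges G| + #|edges H| + #|T| * #|U|.
Proof.
rewrite [edges _]/(join_edges G H) /join_edges.
set E1 := [set _ | e in edges G]; set E2 := [set _ | e in edges H].
set E3 := [set _ | _ in _, _ in _].
have cardE1 : #|E1| = #|edges G| by rewrite card_imset //; apply: imset_inj.
have cardE2 : #|E2| = #|edges H| by rewrite card_imset //; apply: imset_inj.
have cardE3 : #|E3| = #|T| * #|U|.
  rewrite /E3 curry_imset2X card_imset ?cardsX ?cardsT //.
  by move=> [a b] [c d] /eq_set2[[[->] [->]]|[]].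
have E12 : E1 :&: E2 = set0.
  apply/eqP/set0Pn=> -[e /setIP[/imsetP[e1 e1G ->]]].
  have /cards2P[x [y [_ ->]]] := forall_inP (edgesP G) e1 e1G.
  case/imsetP=> e2 _ /setP/(_ (inl x)).
  by rewrite imset_f ?set21 // => /esym/imsetP[].
have E123 : (E1 :|: E2) :&: E3 = set0.
  apply/eqP/set0Pn=> -[e /setIP[E12e /imset2P[a b _ _ eab]]].
  move: E12e; rewrite {}eab => /setUP[]/imsetP[e' _ /setP eq_e].
    by have := eq_e (inr b); rewrite set22 => /esym/imsetP[].
  by have := eq_e (inl a); rewrite set21 => /esym/imsetP[].
by rewrite cardsU E123 cardsU E12 cards0 !subn0 cardE1 cardE2 cardE3.
Qed.

End Join.

(** * Non-existence for joins of a single edge *)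

(** The vertices of G have too few neighbours to be centres, except for one end
    u of the edge, which then has all its k incident edges in a single star.
    This forces every vertex of H to beat precisely the vertices of G other
    than u, and leaves it an out-degree that is not a multiple of k. *)
Lemma join_no_star_decomposition (T U : finType) (G : sgraph T) (H : sgraph U)
    k m :
  1 < k -> #|edges G| = 1 -> #|T| = 2 * k * m + 2 -> #|U| < k ->
  ~ exists D, star_decomposition k (join G H) D.
Proof.
move=> k_gt1 /sgraph_one_edge[u [v [_ defG]]] cardT ltUk.
have k_gt0 : 0 < k by apply: ltnW.
have inl_inj : injective (@inl T U) by move=> ? ? [].
have inr_inj : injective (@inr T U) by move=> ? ? [].
case/(star_decompositionP _ k_gt0)=> N [NE Nasym Ndvd].
(* u is the end of the edge from which it is oriented. *)
wlog uv : u v defG / inl v \in N (inl u).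
  move=> wl; have: [set u; v] \in edges G by rewrite defG set11.
  rewrite -(mem_join_inl G H) NE => /orP[|]; last exact: wl.
  by apply: wl; rewrite setUC.
have edge_inl t t' : inl t' \in N (inl t) ->
    (t = u /\ t' = v) \/ (t = v /\ t' = u).
  move=> tt'; apply: eq_set2; apply/set1P.
  by rewrite -defG -(mem_join_inl G H) NE tt' orbT.
have small_out t : t != u -> N (inl t) = set0.
  move=> neq_tu; apply/eqP; rewrite -cards_eq0; apply: contraTT (Ndvd (inl t)).
  rewrite -lt0n => ?; rewrite gtnNdvd //; apply: leq_ltn_trans ltUk.
  rewrite -cardsT -(card_imset _ inr_inj); apply/subset_leq_card/subsetP.
  case=> [t' tt'|y _]; last by rewrite imset_f ?inE.
  case: (edge_inl _ _ tt') => [[tu _]|[tv t'u]].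
    by rewrite tu eqxx in neq_tu.
  by move/negP: (Nasym _ _ uv); rewrite -tv -t'u.
have sNu : N (inl u) \subset inl v |: inr @: [set: U].
  apply/subsetP=> -[t' ut'|y _]; last by rewrite !inE imset_f ?orbT ?inE.
  rewrite !inE; apply/orP; left.
  by case: (edge_inl _ _ ut') => [[_ ->]|[-> ->]].
have cardR : #|inl v |: inr @: [set: U]| = #|U|.+1 :> nat.
  rewrite cardsU1 card_imset // cardsT.
  by case: imsetP => // -[].
have geNu : k <= #|N (inl u)|.
  by apply: dvdn_leq (Ndvd _); apply/card_gt0P; exists (inl v).
have cardU : #|U|.+1 = k.
  by apply/eqP; rewrite eqn_leq ltUk -cardR (leq_trans geNu) ?subset_leq_card.
have Nu : N (inl u) = inl v |: inr @: [set: U].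
  by apply/eqP; rewrite eqEcard sNu cardR cardU.
have U_gt0 : 0 < #|U| by lia.
have /card_gt0P[w _] := U_gt0.
(* w beats all of G but u, and at most k - 2 other vertices. *)
have sNw : inl @: [set~ u] \subset N (inr w).
  apply/subsetP=> _ /imsetP[t tu ->]; rewrite !inE in tu.
  by have := mem_join_inlr G H t w; rewrite NE small_out // inE orbF.
have rest : N (inr w) :\: inl @: [set~ u] \subset inr @: [set~ w].
  apply/subsetP=> -[t|y]; rewrite inE => /andP[notL wt].
    have eq_tu : t = u.
      by apply: contraNeq notL => neq_tu; rewrite imset_f // !inE.
    move/negP: (Nasym _ _ wt); rewrite eq_tu Nu => -[].
    by rewrite !inE imset_f ?orbT ?inE.
  rewrite imset_f // !inE; apply: contraTneq wt => ->.
  by apply/negP=> ww; move/negP: (Nasym _ _ ww).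
have := subset_leq_card rest; rewrite cardsDS // !card_imset //.
rewrite !cardsC1 cardT addn2 /= => le_rest.
have := subset_leq_card sNw.
rewrite card_imset // cardsC1 cardT addn2 /= => ge_N.
have : k %| (#|N (inr w)| - (2 * k * m).+1).+1.
  by rewrite -subSn // subSS dvdn_sub // mulnAC dvdn_mull.
rewrite gtnNdvd // -[X in _ < X]cardU ltnS -[X in _ < X](prednK U_gt0).
by rewrite ltnS.
Qed.

(** Writing s for the order of U, twice the number of edges of the join is
    2 + s(s - 1) + 2(2km + 2)s = (s + 1)(s + 2) + 4kms, and 2 is invertible
    modulo the odd number k. *)
Lemma dvdn_edges_join_complete (T U : finType) (G : sgraph T) k m :
  odd k -> #|edges G| = 1 -> #|T| = 2 * k * m + 2 ->
  (k %| #|edges (join G (complete U))|) = (k %| #|U|.+1 * #|U|.+2).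
Proof.
move=> k_odd cardG cardT; rewrite card_join cardG card_draws cardT.
rewrite -(@Gauss_dvdr k 2) ?coprimen2 //; set s := #|U|.
have bin2s : 2 * 'C(s, 2) = s * s.-1.
  by rewrite mulnC -[2]/(2`!) bin_ffact ffactnS ffactn1.
have -> : 2 * (1 + 'C(s, 2) + (2 * k * m + 2) * s) =
    s.+1 * s.+2 + k * (4 * m * s).
  rewrite !mulnDr bin2s; case: s {bin2s} => [|s] /=; nia.
by rewrite dvdn_addl // dvdn_mulr.
Qed.

Lemma primepower_dvdn_coprime_mul p a m n :
  prime p -> coprime m n -> p ^ a %| m * n -> (p ^ a %| m) || (p ^ a %| n).
Proof.
move=> p_pr co_mn; have [pm|] := boolP (p %| m).
  by rewrite Gauss_dvdl ?coprimeXl ?(coprime_dvdl pm) // => ->.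
rewrite -prime_coprime // => co_pm.
by rewrite Gauss_dvdr ?coprimeXl // orbC => ->.
Qed.

Theorem lemma9 (k n : nat) (T : finType) (L : sgraph T)
    (hk : 2 <= k) (hn : 2 <= n) (k_odd : odd k) (hnk : n = 2 %[mod 2 * k])
    (order_L : #|T| = n) (size_L : #|edges L| = 1) :
  [/\ exists D : {set {set {set T}}},
        partial_star_decomposition k (complete T) D
        /\ leave (complete T) D = L,
      ~ (exists D : {set {set {set T + 'I_(k - 1)}}},
           star_decomposition k (join L (complete 'I_(k - 1))) D)
        /\ #|edges (join L (complete 'I_(k - 1)))| = 0 %[mod k]
    & (exists p a : nat, [/\ prime p, odd p, 0 < a & k = p ^ a]) ->
      forall s : nat, s < 2 * k - 2 ->
        ~ (exists D : {set {set {set T + 'I_s}}},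
             star_decomposition k (join L (complete 'I_s)) D)].
Proof.
have k_gt0 : 0 < k by apply: ltnW.
have {hn hnk order_L} [m cardT] : exists m, #|T| = 2 * k * m + 2.
  exists (n %/ (2 * k)); rewrite order_L [LHS](divn_eq n (2 * k)) hnk mulnC.
  by rewrite [2 %% _]modn_small //; lia.
have few s : s < k ->
    ~ exists D, star_decomposition k (join L (complete 'I_s)) D.
  move=> lt_sk; apply: join_no_star_decomposition size_L cardT _ => //.
  by rewrite card_ord.
have dvdE s : (k %| #|edges (join L (complete 'I_s))|) = (k %| s.+1 * s.+2).
  by rewrite (dvdn_edges_join_complete _ k_odd size_L cardT) card_ord.
split.
- have [u [v [neq_uv defL]]] := sgraph_one_edge size_L.
  apply: partial_star_decomposition_leave => //.
    by rewrite defL sub1set inE cards2 neq_uv.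
  by rewrite defL; apply: star_orientation_complete_minus_edge cardT.
- split; first by apply: few; lia.
  apply/eqP; rewrite mod0n -/(k %| _) dvdE.
  by rewrite (_ : (k - 1).+1 = k) ?dvdn_mulr //; lia.
case=> p [a [p_pr _ _ def_k]] s lt_s [D decD].
have [|le_ks] := ltnP s k; first by move/few; apply; exists D.
have := dvdn_card_edges decD; rewrite dvdE def_k.
move/(primepower_dvdn_coprime_mul p_pr (coprimenS _)).
rewrite -{}def_k => /orP[]/dvdnP[[|[|q]]]; rewrite ?mulSn; lia.
Qed.
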